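(* Let $f:\mathbb{R}^d\to\mathbb{R}$ be $\ell$-smooth with $\ell>0$ and let $f(x_0)-\min_{x\in\mathbb{R}^d}f(x)\le\Delta$. Run AMSGrad-norm in the deterministic setting with $\gamma_t=\frac{\gamma}{(t+1)^\alpha}$, $v_0>0$ and $\beta_1=\beta_2=0$, i.e. set $\hat v_0=v_0$ and for $t=0,1,2,\dots$ $$\hat v_{t+1}=\max\{\hat v_t,\|\nabla f(x_t)\|\},\qquad x_{t+1}=x_t-\frac{\gamma}{(t+1)^\alpha\,\hat v_{t+1}}\nabla f(x_t).$$ Then for any $\gamma>0$, $0<\alpha<1$ and every integer $T\ge1$: if $v_0\ge\gamma\ell$, $$\frac1T\sum_{t=0}^{T-1}\|\nabla f(x_t)\|^2\le\frac{2\Delta}{\gamma T^{1-\alpha}}\max\{v_0,\sqrt{2\ell\Delta}\};$$ if $v_0<\gamma\ell$, $$\frac1T\sum_{t=0}^{T-1}\|\nabla f(x_t)\|^2\le\frac{\left(\frac{\ell\gamma}{v_0}\right)^{1/\alpha}\gamma^2\ell^2}{T}+\frac{2(M+\Delta)}{\gamma T^{1-\alpha}}\max\{\gamma\ell,\sqrt{2\ell(M+\Delta)}\},$$ where $$M=\begin{cases}\ell\gamma^2\left(1+\log\left(\frac{\ell\gamma}{v_0}\right)\right), & \alpha=1/2,\\[1mm] \dfrac{\ell\gamma^2}{2(1-2^{1-2\alpha})}, & 1/2<\alpha<1,\\[2mm] \dfrac{\gamma(\ell\gamma)^{\frac1\alpha-1}}{2(1-2\alpha)\,v_0^{\frac1\alpha-2}},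 & 0<\alpha<1/2.\end{cases}$$
   Context: A function $f:\mathbb{R}^d\to\mathbb{R}$ is $\ell$-smooth if it is differentiable and $\|\nabla f(x_1)-\nabla f(x_2)\|\le \ell\|x_1-x_2\|$ for all $x_1,x_2\in\mathbb{R}^d$. ''Deterministic setting'' means exact gradients $\nabla f(x_t)$ are used. $\log$ is the natural logarithm. *)

(* Defs.v *)
From HB Require Import structures.
From mathcomp Require Import all_boot all_order all_algebra.
From mathcomp Require Import all_classical all_reals all_analysis.

Set Implicit Arguments.
Unset Strict Implicit.
Unset Printing Implicit Defensive.

Import Order.TTheory GRing.Theory Num.Theory.
Import numFieldNormedType.Exports.

Local Open Scope ring_scope.

(* The library norm `|v| on 'rV[R]_d is the sup norm; the norm used here is the
   Euclidean one. *)
Definition enorm (R : realType) (d : nat) (v : 'rV[R]_d) : R :=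
  Num.sqrt (\sum_(i < d) v 0 i ^+ 2).

Definition gradient (R : realType) (d : nat) (f : 'rV[R]_d -> R)
    (x : 'rV[R]_d) : 'rV[R]_d :=
  \row_(i < d) 'D_(delta_mx 0 i) f x.

(* Differentiability refers to the sup-norm topology on 'rV[R]_d; in finite
   dimension this is the same as for the Euclidean norm. *)
Definition smooth (R : realType) (d : nat) (l : R) (f : 'rV[R]_d -> R) : Prop :=
  (forall x, differentiable f x) /\
  (forall x1 x2,
     enorm (gradient f x1 - gradient f x2) <= l * enorm (x1 - x2)).

(* Run of AMSGrad-norm with exact gradients and no momentum
   (beta_1 = beta_2 = 0), with step sizes gam, started at x0 and v0;
   vhat is the sequence of the max-accumulators. *)
Definition amsgrad_norm (R : realType) (d : nat) (f : 'rV[R]_d -> R)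
    (gam : nat -> R) (x0 : 'rV[R]_d) (v0 : R)
    (x : nat -> 'rV[R]_d) (vhat : nat -> R) : Prop :=
  [/\ x 0%N = x0,
      vhat 0%N = v0,
      forall t, vhat t.+1 = Num.max (vhat t) (enorm (gradient f (x t))) &
      forall t, x t.+1 = x t - (gam t / vhat t.+1) *: gradient f (x t)].

Definition constM (R : realType) (l gamma v0 alpha : R) : R :=
  if alpha == 1 / 2 then l * gamma ^+ 2 * (1 + ln (l * gamma / v0))
  else if 1 / 2 < alpha then
    l * gamma ^+ 2 / (2 * (1 - 2 `^ (1 - 2 * alpha)))
  else
    gamma * (l * gamma) `^ (1 / alpha - 1)
      / (2 * (1 - 2 * alpha) * v0 `^ (1 / alpha - 2)).

(* Main.v *)
(* The descent lemma gives
     f (x t.+1) <= f (x t) - eta |g|^2 + (l/2) eta^2 |g|^2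
   with eta = gamma / ((t+1)^alpha vhat t.+1) and g = gradient f (x t), and
   (t+1)^alpha vhat t.+1 is nondecreasing.  Let n be the first time at which it
   reaches gamma l.  Before n, vhat and hence |g| stay below gamma l, n is at
   most (gamma l / v0)^(1/alpha), and f has increased by at most
   (l gamma^2 / 2) \sum_(t < n) (t+1)^(-2 alpha) <= M, because |g| <= vhat t.+1.
   From n on, eta <= 1/l, so every step decreases f by at least eta |g|^2 / 2;
   since |g|^2 <= 2 l (f - min f), vhat stays below the stated maximum, and the decreases sum up to the claimed bound.  If
   gamma l <= v0 then n = 0. *)
Require Import Defs.
From HB Require Import structures.
From mathcomp Require Import all_boot all_order all_algebra.
From mathcomp Require Import all_classical all_reals all_analysis.
From mathcomp Require Import ring lra.

Set Implicit Arguments.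
Unset Strict Implicit.

Import Order.TTheory GRing.Theory Num.Theory.
Import numFieldNormedType.Exports.

Local Open Scope ring_scope.

(** * Euclidean inner product and Cauchy-Schwarz *)

Definition dot (R : realType) (d : nat) (u v : 'rV[R]_d) : R :=
  \sum_(i < d) u 0 i * v 0 i.

Lemma enorm_ge0 (R : realType) (d : nat) (v : 'rV[R]_d) : 0 <= enorm v.
Proof. exact: sqrtr_ge0. Qed.

Lemma sqr_enorm (R : realType) (d : nat) (v : 'rV[R]_d) :
  enorm v ^+ 2 = \sum_(i < d) v 0 i ^+ 2.
Proof. by rewrite sqr_sqrtr// sumr_ge0// => i _; exact: sqr_ge0. Qed.

Lemma dotvv (R : realType) (d : nat) (v : 'rV[R]_d) : dot v v = enorm v ^+ 2.
Proof. by rewrite sqr_enorm; apply: eq_bigr => i _; rewrite expr2. Qed.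

Lemma dotZr (R : realType) (d : nat) (a : R) (u v : 'rV[R]_d) :
  dot u (a *: v) = a * dot u v.
Proof. by rewrite mulr_sumr; apply: eq_bigr => i _; rewrite !mxE; ring. Qed.

Lemma dotBl (R : realType) (d : nat) (u w v : 'rV[R]_d) :
  dot (u - w) v = dot u v - dot w v.
Proof. by rewrite -sumrB; apply: eq_bigr => i _; rewrite !mxE; ring. Qed.

Lemma enormZ (R : realType) (d : nat) (a : R) (v : 'rV[R]_d) :
  enorm (a *: v) = `|a| * enorm v.
Proof.
rewrite /enorm -sqrtr_sqr -sqrtrM ?sqr_ge0//; congr Num.sqrt.
by rewrite mulr_sumr; apply: eq_bigr => i _; rewrite !mxE exprMn.
Qed.

(* Expanding \sum_i (|v| u_i - |u| v_i)^2 >= 0 and dividing by 2 |u| |v|. *)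
Lemma dot_le_enorm (R : realType) (d : nat) (u v : 'rV[R]_d) :
  dot u v <= enorm u * enorm v.
Proof.
have enorm_eq0 (w : 'rV[R]_d) : enorm w = 0 -> forall i, w 0 i = 0 :> R.
  move=> w0 i; have /eqP := sqr_enorm w; rewrite w0 expr0n/= eq_sym.
  rewrite psumr_eq0; last by move=> j _; exact: sqr_ge0.
  by move/allP/(_ i (mem_index_enum _)); rewrite sqrf_eq0 => /eqP.
have [v0|v0] := eqVneq (enorm v) 0.
  rewrite v0 mulr0 /dot big1// => i _.
  by rewrite (enorm_eq0 _ v0) mulr0.
have [u0|u0] := eqVneq (enorm u) 0.
  rewrite u0 mul0r /dot big1// => i _.
  by rewrite (enorm_eq0 _ u0) mul0r.
have vu_gt0 : 0 < 2 * (enorm v * enorm u).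
  by rewrite !mulr_gt0// lt_neqAle eq_sym ?v0 ?u0 enorm_ge0.
have : 0 <= \sum_(i < d) (enorm v * u 0 i - enorm u * v 0 i) ^+ 2.
  by apply: sumr_ge0 => i _; exact: sqr_ge0.
have -> : \sum_(i < d) (enorm v * u 0 i - enorm u * v 0 i) ^+ 2 =
    enorm v ^+ 2 * (\sum_(i < d) u 0 i ^+ 2)
    - 2 * (enorm v * enorm u) * dot u v
    + enorm u ^+ 2 * (\sum_(i < d) v 0 i ^+ 2).
  rewrite /dot !mulr_sumr -sumrB -big_split/=.
  by apply: eq_bigr => i _; ring.
rewrite -!sqr_enorm => h; rewrite -(ler_pM2l vu_gt0) -subr_ge0.
by apply: le_trans h _; rewrite le_eqVlt; apply/orP; left; apply/eqP; ring.
Qed.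

(** * Smooth functions: directional derivatives and the descent lemma *)

Lemma derive_gradient (R : realType) (d : nat) (f : 'rV[R]_d -> R)
    (x v : 'rV[R]_d) :
  differentiable f x -> 'D_v f x = dot (gradient f x) v.
Proof.
move=> df; rewrite deriveE// {1}(row_sum_delta v) linear_sum.
apply: eq_bigr => i _; rewrite linearZ /= mulrC; congr (_ * _).
by rewrite mxE deriveE.
Qed.

Lemma is_derive_line (R : realType) (d : nat) (f : 'rV[R]_d -> R)
    (x v : 'rV[R]_d) (s : R) :
  differentiable f (x + s *: v) ->
  is_derive s 1 (fun s : R => f (x + s *: v))
    (dot (gradient f (x + s *: v)) v).
Proof.
move=> df; have := diff_derivable (v := v) df.
(* The difference quotient of [f] at [x + s v] along [v] is that of the restriction to the line,
   once [h v + s v] is regrouped as [(h + s) v]. *)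
have quot : (fun h : R => h^-1 *: ((f (h *: v + (x + s *: v)) : R)
                                   - f (x + s *: v)))
  = (fun h : R => h^-1 *: ((f (x + (h *: (1 : R) + s) *: v) : R)
                           - f (x + s *: v))).
  apply/funext => h; congr (_ *: (f _ - _)).
  by rewrite [h *: (1 : R)]mulr1 scalerDl addrCA.
rewrite -derive_gradient// /derivable /derive quot => cv.
by apply: DeriveDef.
Qed.

(* Mean value theorem for s |-> f (x + s v) - s <grad f x, v> - s^2 (l/2) |v|^2,
   whose derivative is nonpositive on [0, 1]. *)
Lemma smooth_descent (R : realType) (d : nat) (l : R) (f : 'rV[R]_d -> R)
    (x v : 'rV[R]_d) :
  smooth l f ->
  f (x + v) <= f x + dot (gradient f x) v + l / 2 * enorm v ^+ 2.
Proof.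
move=> [df lip].
pose c := dot (gradient f x) v; pose q := l / 2 * enorm v ^+ 2.
pose psi := (fun s : R => f (x + s *: v)) - (fun s : R => s * c)
            - (fun s : R => s ^+ 2 * q).
pose dpsi (s : R) := dot (gradient f (x + s *: v)) v - c - (s *+ 2) * q.
have dpsiE s : is_derive s (1 : R) psi (dpsi s).
  have h1 := is_derive_line (df (x + s *: v)).
  have h2 : is_derive s (1 : R) (fun s : R => s * c) c.
    by apply: is_derive_eq; rewrite scaler0 add0r [c *: _]mulr1.
  have h3 : is_derive s (1 : R) (fun s : R => s ^+ 2 * q) (s *+ 2 * q).
    apply: is_derive_eq; rewrite scaler0 add0r [s%:A]mulr1 -mulr2n.
    exact: mulrC.
  by apply: is_deriveB.
have cpsi : {within `[(0 : R), 1], continuous psi}%classic.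
  apply: derivable_within_continuous => s _.
  by have [] := dpsiE s.
have [s] := @MVT _ psi dpsi 0 1 ltr01 (fun s _ => dpsiE s) cpsi.
rewrite in_itv/= => /andP[s0 s1].
have := lip (x + s *: v) x.
have -> : x + s *: v - x = s *: v by rewrite addrAC subrr add0r.
rewrite enormZ gtr0_norm// => lips.
(* By Cauchy-Schwarz and the Lipschitz bound the inner product is at most [s l |v|^2], exactly what
   the quadratic term subtracts. *)
have : dpsi s <= 0.
  rewrite /dpsi /c -dotBl /q.
  have := dot_le_enorm (gradient f (x + s *: v) - gradient f x) v.
  have := ler_wpM2r (enorm_ge0 v) lips.
  by move: (dot _ _) (enorm v) (enorm _) => A B C; lra.
rewrite /psi !fctE/= scale1r scale0r addr0 -/c -/q.
lra.
Qed.

(* One gradient step of length 1/l from x lands no lower than the minimum. *)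
Lemma smooth_sqr_gradient_le (R : realType) (d : nat) (l : R)
    (f : 'rV[R]_d -> R) (xmin x : 'rV[R]_d) :
  0 < l -> smooth l f -> (forall y, f xmin <= f y) ->
  enorm (gradient f x) ^+ 2 <= 2 * l * (f x - f xmin).
Proof.
move=> l0 sf fmin.
have := smooth_descent x (- l^-1 *: gradient f x) sf.
move/(le_trans (fmin _)); rewrite dotZr dotvv enormZ normrN exprMn.
rewrite (gtr0_norm (_ : 0 < l^-1)) ?invr_gt0//.
move: (enorm _ ^+ 2) => G.
have -> : l / 2 * (l^-1 ^+ 2 * G) = l^-1 * G / 2 by field; rewrite gt_eqF.
move=> h.
have : l^-1 * G <= 2 * (f x - f xmin) by lra.
by rewrite ler_pdivrMl// => /le_trans; apply; rewrite mulrA (mulrC 2).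
Qed.

(** * Partial sums of the powers [(t+1)^(-p)] *)

(* Young's inequality for x^q * 1 with exponents 1/q and 1/(1-q). *)
Lemma bernoulli_powR (R : realType) (x q : R) :
  0 <= x -> 0 < q -> q < 1 -> x `^ q <= q * x + (1 - q).
Proof.
move=> x0 q0 q1.
have q1' : 0 < 1 - q by lra.
have := @conjugate_powR R (x `^ q) 1 q^-1 (1 - q)^-1 (powR_ge0 _ _) ler01.
rewrite !invr_gt0 !invrK => /(_ q0 q1'); rewrite mulr1 powR1 -powRrM.
rewrite divff ?gt_eqF// powRr1// mul1r (mulrC x) => -> //; lra.
Qed.

(** Induction on [N]. With [q = 1 - p], the step reduces to [(N/(N+1))^q + q/(N+1) <= 1], which is
    Bernoulli's inequality at [N/(N+1)]. *)
Lemma sum_powRN_le_powR (R : realType) (p : R) (N : nat) :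
  0 < p -> p < 1 ->
  \sum_(t < N) t.+1%:R `^ (- p) <= (N%:R : R) `^ (1 - p) / (1 - p).
Proof.
move=> p0 p1; have q0 : 0 < 1 - p by lra.
elim: N => [|N IH]; first by rewrite big_ord0 divr_ge0 ?powR_ge0 ?ltW.
rewrite big_ord_recr/=; apply: le_trans (lerD IH (lexx _)) _.
have N1 : 0 < N.+1%:R :> R by [].
have x0 : 0 <= N%:R / N.+1%:R :> R by rewrite divr_ge0.
have B := bernoulli_powR x0 q0 (_ : 1 - p < 1).
have -> : N.+1%:R `^ (- p) = N.+1%:R `^ (1 - p) / N.+1%:R :> R.
  rewrite [X in _ `^ X = _](_ : - p = 1 - p - 1); last by ring.
  by rewrite (@powRB _ _ (1 - p) 1) ?pnatr_eq0 ?implybT// powRr1.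
rewrite [X in X `^ (1 - p) / (1 - p) + _](_ : N%:R = N%:R / N.+1%:R * N.+1%:R);
  last by rewrite divfK ?gt_eqF.
rewrite (powRM _ x0 (ltW N1)).
have P0 : 0 < N.+1%:R `^ (1 - p) :> R by rewrite powR_gt0.
have -> a b : a * b / (1 - p) + b / N.+1%:R =
    b * ((a + (1 - p) / N.+1%:R) / (1 - p)) :> R.
  by field; rewrite gt_eqF//= nat1r pnatr_eq0.
rewrite ler_pM2l// -[leRHS]div1r ler_pM2r ?invr_gt0//.
apply: le_trans (lerD (B _) (lexx _)) _; first lra.
rewrite le_eqVlt; apply/orP; left; apply/eqP; rewrite -natr1.
by field; rewrite natr1 pnatr_eq0.
Qed.

(** Each new term is paid for by the logarithm's increment, since
    [ln (1 - 1/(N+2)) <= - 1/(N+2)]. *)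
Lemma sum_inv_le_ln (R : realType) (N : nat) :
  \sum_(t < N.+1) (t.+1%:R : R)^-1 <= 1 + ln N.+1%:R.
Proof.
elim: N => [|N IH]; first by rewrite big_ord1 ln1 invr1 addr0.
rewrite big_ord_recr/=; apply: le_trans (lerD IH (lexx _)) _.
have N1 : 0 < N.+1%:R :> R by [].
have N2 : 0 < N.+2%:R :> R by [].
rewrite -addrA lerD2l.
have : ln (N.+1%:R / N.+2%:R) <= - (N.+2%:R : R)^-1.
  have -> : N.+1%:R / N.+2%:R = 1 + - (N.+2%:R)^-1 :> R.
    rewrite -[N.+2%:R]natr1 -[N.+1%:R]natr1; field.
    by apply: lt0r_neq0; have := ler0n R N; lra.
  apply: le_ln1Dx; rewrite ltrN2 invf_lt1//.
  by rewrite ltr1n.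
rewrite lnM ?posrE ?invr_gt0// lnV ?posrE//.
by move: (ln _) (ln _) (_^-1) => a b c; lra.
Qed.

(* Condensation: pairing the terms 2k and 2k+1 of the partial sums S gives
   S_(2n+1) <= 1 + r S_n with r = 2^(1-p), hence S_n <= 1 + r S_n. *)
Lemma sum_powRN_le_geometric (R : realType) (p : R) (N : nat) :
  1 < p ->
  \sum_(t < N) t.+1%:R `^ (- p) <= (1 - 2 `^ (1 - p))^-1 :> R.
Proof.
move=> p1; set r := 2 `^ (1 - p).
have r1 : r < 1.
  rewrite /r -opprB powRN invf_lt1 ?powR_gt0//.
  have p10 : 0 < p - 1 by lra.
  have := @gt0_ltr_powR R _ p10 1 2.
  by rewrite !nnegrE powR1 !ler0n ltr1n; apply.
pose S n : R := \sum_(t < n) t.+1%:R `^ (- p).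
have SS n : S n <= S n.+1 by rewrite /S big_ord_recr/= lerDl powR_ge0.
have double n : S n.*2.+1 <= 1 + r * S n.
  elim: n => [|n IH].
    by rewrite /S big_ord1 big_ord0 powR1 mulr0 addr0.
  rewrite doubleS /S big_ord_recr big_ord_recr/= -/(S n.*2.+1).
  rewrite big_ord_recr/= -/(S n) mulrDr addrA -addrA.
  apply: lerD => //.
  (* The two new terms have bases [2n+2] and [2n+3]; both are at most [(2n+2)^(-p)], and two copies
     of it make [r (n+1)^(-p)]. *)
  have e : 2 `^ (- p) * n.+1%:R `^ (- p) = n.*2.+2%:R `^ (- p) :> R.
    by rewrite -powRM// -natrM mul2n doubleS.
  have -> : r = 2 * 2 `^ (- p).
    by rewrite /r powRD ?pnatr_eq0 ?implybT// powRr1.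
  rewrite -mulrA e mulr2n mulrDl !mul1r lerD2l.
  rewrite !powRN lef_pV2 ?posrE ?powR_gt0//.
  by rewrite ge0_ler_powR ?nnegrE ?ler_nat//; lra.
have mono m n : (m <= n)%N -> S m <= S n.
  by move=> /subnK <-; elim: (n - m)%N => // k IH; rewrite addSn (le_trans IH).
have := le_trans (mono N N.*2.+1 _) (double N).
rewrite -[(N <= _)%N]/(N <= N.*2.+1)%N -addnn -addnS leq_addr => /(_ isT) h.
rewrite -div1r ler_pdivlMr ?subr_gt0// -/(S N); lra.
Qed.

(** * Scalar analysis of a run, before and after the threshold *)

(* What the proof retains of a run: F is the optimality gap, g the gradient norm
   and v the accumulator. *)
Definition amsgrad_profile (R : realType) (l gamma alpha v0 : R)
    (F g v : nat -> R) : Prop :=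
  [/\ v 0%N = v0,
      forall t, v t.+1 = Num.max (v t) (g t),
      forall t, 0 <= F t,
      forall t, 0 <= g t /\ g t ^+ 2 <= 2 * l * F t &
      forall t, let eta := gamma / t.+1%:R `^ alpha / v t.+1 in
        F t.+1 <= F t - eta * g t ^+ 2 + l / 2 * (eta * g t) ^+ 2].

Lemma amsgrad_profile_v_ge (R : realType) (l gamma alpha v0 : R)
    (F g v : nat -> R) :
  0 < v0 -> amsgrad_profile l gamma alpha v0 F g v -> forall t, v0 <= v t.
Proof.
move=> v00 [v0E vS _ _ _]; elim=> [|t IH]; first by rewrite v0E.
by rewrite vS le_max IH.
Qed.

Lemma amsgrad_profile_v_homo (R : realType) (l gamma alpha v0 : R)
    (F g v : nat -> R) :
  amsgrad_profile l gamma alpha v0 F g v ->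
  {homo v : m n / (m <= n)%N >-> m <= n}.
Proof.
move=> [_ vS _ _ _]; apply: homo_leq => //; first exact: le_trans.
by move=> t; rewrite vS le_max lexx.
Qed.

Lemma powR_natr_ge1 (R : realType) (a : R) (t : nat) :
  0 < a -> 1 <= t.+1%:R `^ a.
Proof.
move=> a0; rewrite -[leLHS](powRr0 t.+1%:R).
by rewrite ler_powR ?ler1n// ltW.
Qed.

(** Past the threshold each step keeps half of its first-order decrease, so the decreases telescope
    to at most [D]. Every step size before [T] is at least [gamma / (T^alpha B)], which turns the
    weighted sum of squares into the plain one. *)
Lemma amsgrad_profile_tail (R : realType) (l gamma alpha v0 c D : R)
    (F g v : nat -> R) (s T : nat) :
  0 < l -> 0 < gamma -> 0 < alpha -> 0 < v0 ->
  amsgrad_profile l gamma alpha v0 F g v ->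
  gamma * l <= s.+1%:R `^ alpha * v s.+1 -> F s <= D -> v s <= c ->
  (s <= T)%N ->
  \sum_(s <= t < T) g t ^+ 2 <=
    2 * D * T%:R `^ alpha / gamma * Num.max c (Num.sqrt (2 * l * D)).
Proof.
move=> l0 gam0 al0 v00 P hs FD vc sT; have [v0E vS Fge0 hg hd] := P.
set B := Num.max _ _.
have vge := amsgrad_profile_v_ge v00 P.
have vhomo := amsgrad_profile_v_homo P.
pose eta t := gamma / t.+1%:R `^ alpha / v t.+1.
have v_gt0 t : 0 < v t by apply: lt_le_trans (vge t).
have a_gt0 t : 0 < t.+1%:R `^ alpha :> R by rewrite powR_gt0.
have eta_gt0 t : 0 < eta t by rewrite !divr_gt0.
have eta_le t : (s <= t)%N -> eta t * l <= 1.
  move=> st; rewrite /eta mulrAC ler_pdivrMr// mul1r mulrAC ler_pdivrMr//.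
  apply: le_trans hs _; rewrite mulrC ler_pM ?powR_ge0 ?(ltW (v_gt0 _))//.
    exact: vhomo.
  by rewrite ge0_ler_powR ?nnegrE ?(ltW al0)// ler_nat.
(* The telescoped descent keeps [F] below [D]; then [g^2 <= 2 l D], so the next accumulator cannot
   exceed [B]. *)
have descent n : F (s + n)%N + \sum_(s <= i < s + n) eta i * g i ^+ 2 / 2 <= D
              /\ v (s + n)%N <= B.
  elim: n => [|n [IHF IHv]].
    rewrite addn0 big_geq// addr0; split=> //.
    by rewrite /B le_max vc.
  rewrite addnS; split.
    rewrite big_nat_recr/= ?leq_addr//.
    have := hd (s + n)%N; rewrite /= -/(eta _).
    have : eta (s + n)%N * l * (eta (s + n)%N * g (s + n)%N ^+ 2)
        <= 1 * (eta (s + n)%N * g (s + n)%N ^+ 2).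
      rewrite ler_wpM2r ?eta_le ?leq_addr//.
      by rewrite mulr_ge0 ?sqr_ge0// ltW.
    rewrite exprMn.
    move: IHF; set S := (\sum_(_ <= _ < _) _).
    by move: (eta _) (g _) => e x; lra.
  rewrite vS ge_max IHv/= /B le_max; apply/orP; right.
  have [g0 gF] := hg (s + n)%N.
  rewrite -[leLHS](ger0_norm g0) -sqrtr_sqr ler_wsqrtr//.
  apply: le_trans gF _; rewrite ler_pM2l ?mulr_gt0//.
  apply: le_trans IHF; rewrite lerDl sumr_ge0// => i _.
  by rewrite divr_ge0// mulr_ge0 ?sqr_ge0// ltW.
have B0 : 0 < B by have [_] := descent 0%N; exact: lt_le_trans.
have [] := descent (T - s)%N; rewrite subnKC// => DT _.
have : \sum_(s <= i < T) eta i * g i ^+ 2 / 2 <= D.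
  by apply: le_trans DT; rewrite lerDr.
(* The empty range is split off because [T] may then be 0, and [T^alpha] could not be divided by. *)
have T0 : s = T \/ 0 < T%:R `^ alpha :> R.
  move: sT; rewrite leq_eqVlt => /predU1P[->|sT]; [by left|right].
  by rewrite powR_gt0// ltr0n (leq_ltn_trans _ sT).
case: T0 => [<- _|T0 SD].
  rewrite big_geq// !mulr_ge0 ?powR_ge0 ?invr_ge0 ?(ltW gam0) ?(ltW B0)//.
  exact: le_trans FD.
have -> : 2 * D * T%:R `^ alpha / gamma * B =
    2 * D * (T%:R `^ alpha / gamma * B) by ring.
rewrite -ler_pdivrMr ?mulr_gt0 ?invr_gt0//.
have SD2 : 2 * (\sum_(s <= i < T) eta i * g i ^+ 2 / 2) <= 2 * D.
  by rewrite ler_pM2l.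
apply: le_trans SD2; rewrite mulr_suml mulr_sumr !big_nat.
apply: ler_sum => i /andP[si iT].
rewrite [leRHS]mulrC divfK ?pnatr_eq0// [leLHS]mulrC ler_wpM2r ?sqr_ge0//.
have -> : T%:R `^ alpha / gamma * B = (gamma / (T%:R `^ alpha * B))^-1.
  by rewrite invf_div mulrAC.
rewrite invrK /eta -mulrA -invfM ler_pM2l// lef_pV2 ?posrE ?mulr_gt0//.
(* The step size at time [i] involves [v i.+1], so the bound by [B] is taken at time [i + 1], still
   at most [T]. *)
have [_] := descent (i.+1 - s)%N; rewrite subnKC ?(leq_trans si)// => vB.
rewrite ler_pM ?powR_ge0 ?(ltW (v_gt0 _))//.
by rewrite ge0_ler_powR ?nnegrE ?(ltW al0)// ler_nat.
Qed.

(** Since [(t+1)^alpha >= 1], staying below the threshold bounds [v t.+1] itself, and with it [g t].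
    The increase of [F] is controlled by dropping the first-order decrease and summing the quadratic
    errors. *)
Lemma amsgrad_profile_head (R : realType) (l gamma alpha v0 : R)
    (F g v : nat -> R) (n : nat) :
  0 < l -> 0 < gamma -> 0 < alpha -> 0 < v0 ->
  amsgrad_profile l gamma alpha v0 F g v ->
  (forall t, (t < n)%N -> t.+1%:R `^ alpha * v t.+1 < gamma * l) ->
  [/\ F n <= F 0%N + l * gamma ^+ 2 / 2
               * \sum_(t < n) t.+1%:R `^ (- (2 * alpha)),
      forall t, (t < n)%N -> g t ^+ 2 <= (gamma * l) ^+ 2,
      v n <= Num.max v0 (gamma * l) &
      n%:R <= (l * gamma / v0) `^ (1 / alpha)].
Proof.
move=> l0 gam0 al0 v00 P hn; have [v0E vS Fge0 hg hd] := P.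
have vge := amsgrad_profile_v_ge v00 P.
have v_gt0 t : 0 < v t by apply: lt_le_trans (vge t).
have a_gt0 t : 0 < t.+1%:R `^ alpha :> R by rewrite powR_gt0.
have vlt t : (t < n)%N -> v t.+1 < gamma * l.
  move=> /hn; apply: le_lt_trans.
  by rewrite -[leLHS]mul1r ler_pM2r// powR_natr_ge1.
split.
- elim: n {hn vlt} => [|n IH]; first by rewrite big_ord0 mulr0 addr0.
  rewrite big_ord_recr/= mulrDr addrA; apply: le_trans (hd n) _.
  apply: lerD.
    apply: le_trans IH; rewrite lerBlDr lerDl mulr_ge0 ?sqr_ge0//.
    by rewrite !divr_ge0 ?ltW.
  have -> : n.+1%:R `^ (- (2 * alpha)) = (n.+1%:R `^ alpha) ^- 2 :> R.
    by rewrite powRN mulrC powRrM powR_mulrn ?powR_ge0.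
  (* The accumulator already contains the current gradient norm, so normalizing by it leaves only
     the error [gamma^2 / (n+1)^(2 alpha)], up to [l/2]. *)
  have gv : (g n / v n.+1) ^+ 2 <= 1.
    have [g0 _] := hg n.
    rewrite expr_le1// ?divr_ge0 ?(ltW (v_gt0 _))// ler_pdivrMr// mul1r.
    by rewrite vS le_max lexx orbT.
  set A := n.+1%:R `^ alpha in gv *.
  have -> : l / 2 * (gamma / A / v n.+1 * g n) ^+ 2 =
      l * gamma ^+ 2 / 2 / A ^+ 2 * (g n / v n.+1) ^+ 2.
    by field; rewrite !gt_eqF ?/A.
  by rewrite ler_piMr// !mulr_ge0 ?invr_ge0 ?sqr_ge0 ?ltW.
- move=> t /vlt /ltW gv; have [g0 _] := hg t.
  rewrite ler_sqr ?nnegrE ?(mulr_ge0 (ltW gam0) (ltW l0))//.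
  by apply: le_trans gv; rewrite vS le_max lexx orbT.
- case: n hn vlt => [|n] _ vlt; first by rewrite v0E le_max lexx.
  by rewrite le_max (ltW (vlt n _)) ?orbT.
- case: n hn vlt => [|n] hn _; first by rewrite powR_ge0.
  (* The last time before the threshold gives [(n+1)^alpha v0 < gamma l], and taking the power
     [1/alpha] bounds [n+1]. *)
  have -> : n.+1%:R = (n.+1%:R `^ alpha) `^ (1 / alpha) :> R.
    by rewrite -powRrM div1r divff ?gt_eqF// powRr1.
  rewrite ge0_ler_powR ?nnegrE ?divr_ge0 ?powR_ge0 ?mulr_ge0 ?(ltW al0)
    ?(ltW l0) ?(ltW gam0) ?(ltW v00)//.
  rewrite ler_pdivlMr// mulrC (mulrC l); apply: le_trans (ltW (hn n _)) => //.
  by rewrite mulrC ler_pM2l.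
Qed.

(** The cases of [constM] follow the exponent [2 alpha]: harmonic at 1, convergent above 1, growing
    like a power of [n] below 1. The bound on [n] enters in the first and the last. *)
Lemma sum_powRN_le_constM (R : realType) (l gamma alpha v0 : R) (n : nat) :
  0 < l -> 0 < gamma -> 0 < alpha -> alpha < 1 -> 0 < v0 -> v0 < gamma * l ->
  n%:R <= (l * gamma / v0) `^ (1 / alpha) ->
  l * gamma ^+ 2 / 2 * \sum_(t < n) t.+1%:R `^ (- (2 * alpha)) <=
    constM l gamma v0 alpha.
Proof.
move=> l0 gam0 al0 al1 v00 vl nle.
have lg2 : 0 < l * gamma ^+ 2 by rewrite mulr_gt0 ?exprn_gt0.
have rho0 : 0 < l * gamma / v0 by rewrite !divr_gt0 ?mulr_gt0.
rewrite /constM; case: ifPn => [/eqP alE|al_neq].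
  rewrite -mulrA ler_pM2l//.
  have ln0 : 0 <= ln (l * gamma / v0).
    by rewrite ln_ge0// ler_pdivlMr// mul1r mulrC ltW.
  (* The harmonic bound needs a nonempty sum; for [n = 0] the nonnegative logarithm suffices. *)
  case: n nle => [|n] nle; first by rewrite big_ord0 mulr0; lra.
  have -> : 2 * alpha = 1 by rewrite alE; field.
  under eq_bigr do rewrite powR_inv1//.
  have := sum_inv_le_ln R n.
  have : ln n.+1%:R <= ln ((l * gamma / v0) `^ (1 / alpha)).
    by rewrite ler_ln ?posrE ?powR_gt0.
  rewrite ln_powR alE; lra.
case: ifPn => [al_gt|]; last rewrite -leNgt => al_le.
  rewrite invfM [leRHS]mulrA ler_pM2l ?divr_gt0//.
  by apply: sum_powRN_le_geometric; lra.
have al_lt : alpha < 1 / 2 by rewrite lt_neqAle al_neq al_le.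
have q0 : 0 < 1 - 2 * alpha by lra.
have := @sum_powRN_le_powR R (2 * alpha) n.
have -> : 0 < 2 * alpha by lra.
have -> : 2 * alpha < 1 by lra.
move=> /(_ isT isT) sumle.
have npow : n%:R `^ (1 - 2 * alpha) <= (l * gamma / v0) `^ (1 / alpha - 2).
  apply: le_trans
    (_ : ((l * gamma / v0) `^ (1 / alpha)) `^ (1 - 2 * alpha) <= _).
    by rewrite ge0_ler_powR ?nnegrE ?powR_ge0// ltW.
  rewrite -powRrM le_eqVlt; apply/orP; left; apply/eqP; congr (_ `^ _).
  by field; rewrite gt_eqF.
apply: le_trans (_ : l * gamma ^+ 2 / 2
    * ((l * gamma / v0) `^ (1 / alpha - 2) / (1 - 2 * alpha)) <= _).
  rewrite ler_pM2l ?divr_gt0//; apply: le_trans sumle _.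
  by rewrite ler_pM2r ?invr_gt0.
(* The two sides agree: a factor [l gamma] taken from [l gamma^2] raises the exponent [1/alpha - 2]
   to [1/alpha - 1]. *)
rewrite le_eqVlt; apply/orP; left; apply/eqP.
rewrite powRM ?invr_ge0 ?mulr_ge0 ?ltW//.
have -> : v0^-1 `^ (1 / alpha - 2) = (v0 `^ (1 / alpha - 2))^-1.
  by rewrite -powR_inv1 ?(ltW v00)// -powRrM mulN1r powRN.
have -> : (l * gamma) `^ (1 / alpha - 1) =
    (l * gamma) `^ (1 / alpha - 2) * (l * gamma).
  rewrite [RHS]mulrC (_ : 1 / alpha - 2 = 1 / alpha - 1 - 1); last by ring.
  rewrite mulr_powRB1 ?mulr_ge0 ?(ltW l0) ?(ltW gam0)//.
  by rewrite subr_gt0 ltr_pdivlMr// mul1r.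
have V0 : 0 < v0 `^ (1 / alpha - 2) by rewrite powR_gt0.
field.
by rewrite !gt_eqF.
Qed.

(** * From the vector iteration to its scalar profile, and the averaged bounds *)

Lemma amsgrad_norm_profile (R : realType) (d : nat) (f : 'rV[R]_d -> R)
    (l gamma alpha v0 : R) (x0 xmin : 'rV[R]_d) (x : nat -> 'rV[R]_d)
    (vhat : nat -> R) :
  0 < l -> smooth l f -> (forall y, f xmin <= f y) ->
  amsgrad_norm f (fun t => gamma / (t.+1%:R `^ alpha)) x0 v0 x vhat ->
  amsgrad_profile l gamma alpha v0 (fun t => f (x t) - f xmin)
    (fun t => enorm (gradient f (x t))) vhat.
Proof.
move=> l0 sf fmin [_ v0E vS xS]; split=> //.
- by move=> t; rewrite subr_ge0.
- by move=> t; split; [exact: enorm_ge0 | exact: smooth_sqr_gradient_le].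
move=> t /=; set eta := gamma / _ / _.
have := smooth_descent (x t) (- eta *: gradient f (x t)) sf.
rewrite dotZr dotvv enormZ normrN exprMn real_normK ?num_real//.
by rewrite scaleNr -xS -exprMn; lra.
Qed.

Unset Implicit Arguments.
Set Strict Implicit.

Theorem theorem7 (R : realType) (d : nat) (f : 'rV[R]_d -> R)
    (l Delta gamma alpha v0 : R) (x0 xmin : 'rV[R]_d)
    (x : nat -> 'rV[R]_d) (vhat : nat -> R) (T : nat) :
  0 < l -> smooth l f ->
  (forall y, f xmin <= f y) -> f x0 - f xmin <= Delta ->
  0 < gamma -> 0 < alpha -> alpha < 1 -> 0 < v0 ->
  amsgrad_norm f (fun t => gamma / (t.+1%:R `^ alpha)) x0 v0 x vhat ->
  (1 <= T)%N ->
  let M := constM l gamma v0 alpha in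
  let avg := T%:R^-1 * \sum_(t < T) enorm (gradient f (x t)) ^+ 2 in
  (gamma * l <= v0 ->
     avg <= 2 * Delta / (gamma * T%:R `^ (1 - alpha))
              * Num.max v0 (Num.sqrt (2 * l * Delta))) /\
  (v0 < gamma * l ->
     avg <= (l * gamma / v0) `^ (1 / alpha) * gamma ^+ 2 * l ^+ 2 / T%:R
            + 2 * (M + Delta) / (gamma * T%:R `^ (1 - alpha))
              * Num.max (gamma * l) (Num.sqrt (2 * l * (M + Delta)))).
Proof.
move=> l0 sf fmin fDelta gam0 al0 al1 v00 run T1 M avg.
have P := amsgrad_norm_profile l0 sf fmin run.
have [xE v0E _ _] := run.
have vge := amsgrad_profile_v_ge v00 P.
have T0 : 0 < T%:R :> R by rewrite ltr0n.
have TaE : T%:R `^ (1 - alpha) = T%:R / T%:R `^ alpha.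
  by rewrite powRB ?pnatr_eq0 ?(gtn_eqF T1) ?implybT// powRr1 ?ltW.
have Ta0 : 0 < T%:R `^ alpha :> R by rewrite powR_gt0.
have avgE D B : T%:R^-1 * (2 * D * T%:R `^ alpha / gamma * B) =
    2 * D / (gamma * T%:R `^ (1 - alpha)) * B.
  by rewrite TaE; field; rewrite !gt_eqF.
split=> hv0.
  rewrite -avgE ler_pM2l ?invr_gt0// -(big_mkord xpredT
    (fun t => enorm (gradient f (x t)) ^+ 2)).
  apply: (amsgrad_profile_tail l0 gam0 al0 v00 P) => //; last 2 first.
  - by rewrite xE.
  - by rewrite v0E.
  (* The threshold is met at time 0, where [(0+1)^alpha = 1] and [vhat 1] is at least [v0]. *)
  by rewrite powR1 mul1r (le_trans hv0).
have [|n hn nmin] := @ex_minnP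
  (fun t => gamma * l <= t.+1%:R `^ alpha * vhat t.+1).
  (* For [t] the integer part of [(gamma l / v0)^(1/alpha)], [(t+1)^alpha] exceeds [gamma l / v0],
     and [vhat] never drops below [v0]. *)
  exists (Num.truncn ((gamma * l / v0) `^ (1 / alpha))).
  set r := _ `^ (1 / alpha).
  have r0 : 0 <= r by rewrite powR_ge0.
  have : gamma * l / v0 = r `^ alpha.
    by rewrite /r -powRrM div1r mulVf ?gt_eqF// powRr1//
      !mulr_ge0 ?invr_ge0 ?ltW.
  move/(canRL (divfK (lt0r_neq0 v00))) => ->.
  rewrite ler_pM ?powR_ge0 ?(ltW v00)//.
  by rewrite ge0_ler_powR ?nnegrE ?(ltW al0)// ltW// truncnS_gt.
have before t : (t < n)%N -> t.+1%:R `^ alpha * vhat t.+1 < gamma * l.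
  by rewrite ltNge; apply: contraL => /nmin; rewrite -leqNgt.
have [Fn gle vn nle] := amsgrad_profile_head l0 gam0 al0 v00 P before.
have FM := sum_powRN_le_constM l0 gam0 al0 al1 v00 hv0 nle.
have FD : f (x n) - f xmin <= M + Delta.
  by apply: le_trans Fn _; rewrite xE addrC lerD.
have D0 : 0 <= M + Delta by apply: le_trans FD; rewrite subr_ge0.
have tail0 : 0 <= 2 * (M + Delta) * T%:R `^ alpha / gamma
    * Num.max (gamma * l) (Num.sqrt (2 * l * (M + Delta))).
  by rewrite !mulr_ge0 ?invr_ge0 ?(ltW gam0) ?(ltW Ta0)
    ?le_max ?sqrtr_ge0 ?orbT.
(* Stated for every [k <= n], because the horizon [T] may end before the threshold time [n]. *)
have headle k : (k <= n)%N ->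
    \sum_(0 <= t < k) enorm (gradient f (x t)) ^+ 2 <=
    (l * gamma / v0) `^ (1 / alpha) * gamma ^+ 2 * l ^+ 2.
  move=> kn; apply: le_trans (_ : k%:R * (gamma * l) ^+ 2 <= _).
    rewrite -[k in leRHS]subn0 mulr_natl -sumr_const_nat !big_nat.
    by apply: ler_sum => t /andP[_ tk]; apply: gle; exact: leq_trans kn.
  rewrite exprMn mulrA !ler_wpM2r ?sqr_ge0//.
  by apply: le_trans nle; rewrite ler_nat.
rewrite -avgE [X in X + _]mulrC -mulrDr ler_pM2l ?invr_gt0//.
rewrite -(big_mkord xpredT (fun t => enorm (gradient f (x t)) ^+ 2)).
(* Either the sum splits at [n] into head and tail, or it is all head and the nonnegative tail bound
   is added for free. *)
have [nT|Tn] := leqP n T.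
  rewrite (big_cat_nat _ nT)//= lerD ?headle//.
  apply: (amsgrad_profile_tail l0 gam0 al0 v00 P) => //.
  by apply: le_trans vn _; rewrite ge_max lexx ltW.
by rewrite -[leLHS]addr0 lerD ?headle// ltnW.
Qed.
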